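(* Let $\alpha$ be irrational. For every real $\gamma>0$, $$H_\gamma(\alpha)=\Bigl\{x\in\mathbb T:\ \sum_n\|q_nx\|^\gamma<+\infty\Bigr\},$$ and $$H_\infty(\alpha)=\bigl\{x\in\mathbb T:\ \|q_nx\|\to 0 \text{ as } n\to\infty\bigr\}.$$
   Context: $\mathbb T=\mathbb R/\mathbb Z$; $\alpha\in\,]0,1[$; $(a_n)_{n\ge1}$ are the partial quotients and $(p_n/q_n)_{n\ge0}$ the convergents of the continued fraction of $\alpha$ ($p_0=0$, $q_0=1$). $\|x\|$ is the distance to the nearest integer. For $\gamma>0$, $$H_\gamma(\alpha)=\Bigl\{\sum_{n\ge0}b_nq_n\alpha \bmod 1:\ (b_n)_n\in\mathbb Z^{\mathbb N},\ \sum_{n\ge0}(|b_n|/a_{n+1})^\gamma<+\infty\Bigr\},$$ and $$H_\infty(\alpha)=\Bigl\{\sum_{n\ge0}b_nq_n\alpha \bmod 1:\ (b_n)_n\in\mathbb Z^{\mathbb N},\ |b_n|/a_{n+1}\to0\Bigr\}$$ (the series being convergent in $\mathbb T$). *)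

(* Defs.v *)
From HB Require Import structures.
From mathcomp Require Import all_boot all_order all_algebra.
From mathcomp Require Import all_classical all_reals all_analysis.
From mathcomp Require Import ring lra.

Set Implicit Arguments.
Unset Strict Implicit.
Unset Printing Implicit Defensive.

Import Order.TTheory GRing.Theory Num.Theory.
Import numFieldNormedType.Exports.

Local Open Scope classical_set_scope.
Local Open Scope ring_scope.
Local Open Scope quotient_scope.

Section DistInt.
Context {R : realType}.
Implicit Types x y : R.

Definition dist_int x : R := inf [set `|x - m%:~R| | m in [set: int]].

Lemma dist_int_le x (m : int) : dist_int x <= `|x - m%:~R|.
Proof.
apply: ge_inf; last by exists m.
by exists 0 => _ [k _ <-]; exact: normr_ge0.
Qed.

Lemma dist_int_attained x : exists m : int, dist_int x = `|x - m%:~R|.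
Proof.
pose m := Num.floor (x + 2^-1); exists m.
apply/eqP; rewrite eq_le dist_int_le /=.
apply: lb_le_inf; first by exists `|x - m%:~R|; exists m.
move=> _ [k _ <-].
have hm : `|x - m%:~R| <= 2^-1.
  have m1 := floor_le (x + 2^-1).
  have m2 := floorD1_gt (x + 2^-1).
  rewrite intrD in m2; rewrite ler_norml; rewrite -/m in m1 m2.
  by apply/andP; split; lra.
have [->//|km] := eqVneq k m.
have h1 : (1 : R) <= `|m%:~R - k%:~R|.
  by rewrite -intrB -intr_norm -[1]/(1%:~R) ler_int -gtz0_ge1 normr_gt0 subr_eq0 eq_sym.
have := ler_distD x m%:~R (k%:~R : R).
rewrite [`|_ - x|]distrC; lra.
Qed.

Lemma dist_int_ge0 x : 0 <= dist_int x.
Proof. by have [m ->] := dist_int_attained x. Qed.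

Lemma dist_int0 : dist_int (0 : R) = 0.
Proof.
apply/eqP; rewrite eq_le dist_int_ge0 andbT.
by rewrite (le_trans (dist_int_le 0 0))// subrr normr0.
Qed.

Lemma dist_int_eq0 x : dist_int x = 0 -> x \is a Num.int.
Proof.
have [m ->] := dist_int_attained x => /normr0_eq0/eqP.
by rewrite subr_eq0 => /eqP ->; exact: intr_int.
Qed.

Lemma dist_intN x : dist_int (- x) = dist_int x.
Proof.
suff h y : dist_int (- y) <= dist_int y.
  by apply/eqP; rewrite eq_le h -{1}[x]opprK h.
have [m ->] := dist_int_attained y.
by rewrite (le_trans (dist_int_le _ (- m)))// intrN -opprD normrN.
Qed.

Lemma dist_intD x y : dist_int (x + y) <= dist_int x + dist_int y.
Proof.
have [m ->] := dist_int_attained x; have [k ->] := dist_int_attained y.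
rewrite (le_trans (dist_int_le _ (m + k)))// intrD opprD addrACA.
exact: ler_normD.
Qed.

Lemma dist_int_congr x y : x - y \is a Num.int -> dist_int x = dist_int y.
Proof.
suff h u v : u - v \is a Num.int -> dist_int u <= dist_int v.
  move=> xy; apply/eqP; rewrite eq_le h//= h//.
  by rewrite -opprB rpredN.
move=> /intrP[k uv]; have [m ->] := dist_int_attained v.
rewrite (le_trans (dist_int_le _ (m + k)))// intrD -uv.
by have -> : u - (m%:~R + (u - v)) = v - m%:~R by ring.
Qed.

End DistInt.

(* R / Z; Num.int_num_subdef is the predicate behind the qualifier Num.int. *)
Definition torus (R : realType) : Type :=
  Quotient.quot (GRing.ZmodClosed.clone R (@Num.int_num_subdef R) _).

HB.instance Definition _ (R : realType) := Quotient.on (torus R).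
HB.instance Definition _ (R : realType) := GRing.Zmodule.on (torus R).

Definition mod1 (R : realType) (x : R) : torus R := \pi_(torus R) x.

Section Torus.
Context {R : realType}.
Implicit Types t u : torus R.

Definition tnorm t : R := dist_int (repr t).

Lemma tnorm_mod1 (x : R) : tnorm (mod1 x) = dist_int x.
Proof.
apply: dist_int_congr.
have /eqP : repr (mod1 x) = x %[mod torus R] by rewrite reprK.
by rewrite -Quotient.idealrBE.
Qed.

Lemma mod1B (x y : R) : mod1 x - mod1 y = mod1 (x - y).
Proof. by rewrite /mod1 !piE. Qed.

Let mod1_repr t : mod1 (repr t) = t.
Proof. exact: reprK. Qed.

Definition tdist t u : R := tnorm (t - u).

Let tdistxx t : tdist t t = 0.
Proof. by rewrite /tdist -[t]mod1_repr mod1B tnorm_mod1 subrr dist_int0. Qed.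

Let tdist_positivity t u : tdist t u = 0 -> t = u.
Proof.
rewrite /tdist -[t]mod1_repr -[u]mod1_repr mod1B tnorm_mod1 => /dist_int_eq0.
by rewrite Quotient.idealrBE => /eqP.
Qed.

Let tdist_sym t u : tdist t u = tdist u t.
Proof.
rewrite /tdist -[t]mod1_repr -[u]mod1_repr !mod1B !tnorm_mod1.
by rewrite -opprB dist_intN.
Qed.

Let tdist_triangle u t v : tdist t v <= tdist t u + tdist u v.
Proof.
rewrite /tdist -[t]mod1_repr -[u]mod1_repr -[v]mod1_repr !mod1B !tnorm_mod1.
by rewrite (le_trans _ (dist_intD _ _))// addrA subrK.
Qed.

HB.instance Definition _ := isMetric.Build R (torus R)
  tdistxx tdist_positivity tdist_sym tdist_triangle.

End Torus.

Section ContinuedFraction.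
Context {R : realType}.
Variable alpha : R.

(* alpha_0 = alpha, alpha_(n+1) = 1 / (alpha_n - a_n), a_n = [alpha_n], so that
   alpha = [a_0; a_1, a_2, ...]; the integer part is a natural number because
   alpha is only taken positive. *)
Fixpoint complete_quotient (n : nat) : R :=
  if n is m.+1 then
    let y := complete_quotient m in (y - (Num.truncn y)%:R)^-1
  else alpha.

Definition partial_quotient (n : nat) : nat := Num.truncn (complete_quotient n).

(* Denominator q_n of the n-th convergent [a_0; a_1, ..., a_n], with the
   convention q_(-1) = 0. *)
Fixpoint convergent_den (n : nat) : nat :=
  match n with
  | 0 => 1
  | m.+1 => partial_quotient n * convergent_den m +
            (if m is k.+1 then convergent_den k else 0)
  end.

End ContinuedFraction.

Section Groups.
Context {R : realType}.
Variable alpha : R.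
Notation a := (partial_quotient alpha).
Notation q := (convergent_den alpha).

Definition is_expansion (b : nat -> int) (x : torus R) : Prop :=
  series (fun n => mod1 ((b n)%:~R * (q n)%:R * alpha)) @ \oo --> x.

Definition digit_ratio (b : nat -> int) (n : nat) : R :=
  `|(b n)%:~R| / (a n.+1)%:R.

Definition H_gamma (gamma : R) : set (torus R) :=
  [set x | exists b : nat -> int,
     (\sum_(0 <= n <oo) (digit_ratio b n `^ gamma)%:E < +oo)%E /\
     is_expansion b x].

Definition H_infty : set (torus R) :=
  [set x | exists b : nat -> int,
     digit_ratio b n @[n --> \oo] --> (0 : R) /\ is_expansion b x].

End Groups.

(* Main.v *)
Require Import Defs.
From mathcomp Require Import all_boot all_order all_algebra.
From mathcomp Require Import all_classical all_reals all_analysis.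
From mathcomp Require Import ring lra zify.
Import Order.TTheory GRing.Theory Num.Theory.
Import numFieldNormedType.Exports.
Local Open Scope classical_set_scope.
Local Open Scope ring_scope.

Set Implicit Arguments.
Unset Strict Implicit.
Unset Printing Implicit Defensive.

(** Write D_n = q_n alpha - p_n, so that |D_n| <= 1 / q_(n+1), and let
    r_k = |b_k| / a_(k+1) for a sequence of digits b.

    Sparse digits give small ||q_n x||.  If x is the sum of the b_k q_k alpha,
    then ||q_n x|| is at most the sum of the |b_k| ||q_k q_n alpha||.  Reducing
    modulo 1 the factor with the larger index, and using that the denominators
    grow geometrically, one gets |b_k| ||q_k q_n alpha|| <= 2 r_k s^(2 |n - k|)
    for some s < 1 (tnorm_term_le).  Hence ||q_n x|| is bounded by a constant
    times the supremum over k of r_k s^|n - k| (tnorm_expansion_le).  The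
    gamma-th power of a supremum is at most the sum of the gamma-th powers, for
    every gamma > 0, so summability of r_k^gamma is transferred to ||q_n x||^gamma
    by exchanging two sums (summable_tnorm); convergence to 0 is transferred by
    splitting the supremum (cvg_tnorm).

    Small ||q_n x|| give sparse digits.  Let m_n be the integer nearest to q_n x
    and e_n = q_n x - m_n, so |e_n| = ||q_n x||.  Since q_(n+1) = a_(n+1) q_n +
    q_(n-1), the number
      c_n = m_(n+1) - a_(n+1) m_n - m_(n-1) = a_(n+1) e_n + e_(n-1) - e_(n+1)
    is an integer with |c_n| / a_(n+1) <= |e_(n-1)| + |e_n| + |e_(n+1)|
    (digit_ratio_le).  The digits b_n = (-1)^n c_n represent x: D satisfies the
    same recurrence as q, so c_n, being the defect of that recurrence at e, makes
    the sum of the b_n D_n telescope; up to an integer, its partial sums are x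
    plus a combination of two consecutive gaps with coefficients e_N and e_(N+1)
    (sum_digit_gap), which tends to 0 (digit_expansion). *)

(** * Gaps of the convergents *)

Section ContinuedFractionFacts.
Context {R : realType} (alpha : R).
Context (alpha01 : 0 < alpha < 1) (alpha_irr : irrational alpha).
Notation a := (partial_quotient alpha).
Notation q := (convergent_den alpha).

(** The sequences prev_den, prev_num and prev_gap are indexed from -1: at n they
    hold q_(n-1), p_(n-1) and q_(n-1) alpha - p_(n-1), starting from q_(-1) = 0
    and p_(-1) = 1.  With this shift the continued fraction recurrence holds
    from the first index on, and so does the telescoping of the expansion. *)
Definition prev_den (n : nat) : nat := if n is m.+1 then q m else 0.

Fixpoint prev_num (n : nat) : nat :=
  if n is m.+1 then
    if m is k.+1 then a m * prev_num m + prev_num k else 0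
  else 1.

Definition prev_gap (n : nat) : R :=
  (prev_den n)%:R * alpha - (prev_num n)%:R.

Definition frac_quotient (n : nat) : R :=
  complete_quotient alpha n - (a n)%:R.

Lemma prev_denSS n :
  prev_den n.+2 = (a n.+1 * prev_den n.+1 + prev_den n)%N.
Proof. by case: n. Qed.

Lemma prev_gapSS n :
  prev_gap n.+2 = (a n.+1)%:R * prev_gap n.+1 + prev_gap n.
Proof.
rewrite /prev_gap prev_denSS.
have -> : prev_num n.+2 = (a n.+1 * prev_num n.+1 + prev_num n)%N by [].
rewrite !natrD !natrM; ring.
Qed.

Lemma prev_gap_neq0 n : (0 < prev_den n)%N -> prev_gap n != 0.
Proof.
move=> q0; apply/eqP => /eqP; rewrite subr_eq0 => /eqP e.
apply: alpha_irr; exists ((prev_num n)%:R / (prev_den n)%:R) => //.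
rewrite fmorph_div /= !ratr_nat -e mulrAC divff ?mul1r//.
by rewrite pnatr_eq0 -lt0n.
Qed.

(** The gaps are multiplied at each step by minus the fractional part of the
    current complete quotient; hence they alternate in sign.  The induction has
    to carry the three facts together: irrationality keeps the gap, and with it
    the fractional part, away from 0; this makes the next complete quotient
    larger than 1, and so the next denominator positive. *)
Lemma frac_quotient_step n :
  [/\ 0 < frac_quotient n < 1,
      prev_gap n.+1 = - (frac_quotient n * prev_gap n) &
      (0 < prev_den n.+1)%N].
Proof.
elim: n => [|n [/andP[t0 t1] D Q]].
  have a0 : a 0 = 0%N by apply/truncn0Pn; rewrite -ltNge; case/andP: alpha01.
  rewrite /frac_quotient a0 subr0 /prev_gap /=; split => //.
  by rewrite mul1r mul0r subr0 sub0r mulrN mulr1 opprK.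
set c := complete_quotient alpha n.+1.
have cE : c = (frac_quotient n)^-1 by [].
have c1 : 1 < c by rewrite cE invf_gt1.
have c0 : 0 <= c by lra.
have /andP[ac ca] := truncn_itv c0.
have a1 : (1 <= a n.+1)%N by rewrite truncn_gt0 ltW.
have Q2 : (0 < prev_den n.+2)%N.
  by rewrite prev_denSS addn_gt0 muln_gt0 a1 Q.
have D2 : prev_gap n.+2 = - (frac_quotient n.+1 * prev_gap n.+1).
  have tc : frac_quotient n * c = 1 by rewrite cE mulfV// gt_eqF.
  rewrite prev_gapSS /frac_quotient -/c D.
  have -> : frac_quotient n = complete_quotient alpha n - (a n)%:R by [].
  rewrite -/(frac_quotient n).
  transitivity (- ((a n.+1)%:R * (frac_quotient n * prev_gap n)) +
    (frac_quotient n * c) * prev_gap n); last by ring.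
  by rewrite tc; ring.
split => //.
have t2 : 0 <= frac_quotient n.+1 < 1.
  rewrite /frac_quotient -/c /partial_quotient -/c.
  by rewrite -natr1 in ca; apply/andP; split; lra.
move: t2; rewrite le_eqVlt => /andP[/orP[/eqP e|->->//]].
by have := prev_gap_neq0 Q2; rewrite D2 -e mul0r oppr0 eqxx.
Qed.

Lemma partial_quotient_gt0 n : (0 < a n.+1)%N.
Proof.
have [/andP[t0 t1] _ _] := frac_quotient_step n.
by rewrite truncn_gt0 -/(frac_quotient n) ltW// -[ltRHS]/((frac_quotient n)^-1) invf_gt1.
Qed.

Lemma convergent_den_gt0 n : (0 < q n)%N.
Proof. by have [] := frac_quotient_step n. Qed.

Lemma leq_convergent_denS n : (q n <= q n.+1)%N.
Proof.
rewrite -[q n.+1]/(prev_den n.+2) prev_denSS (leq_trans _ (leq_addr _ _))//.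
rewrite leq_pmull//.
exact: partial_quotient_gt0.
Qed.

Lemma leq_partial_quotientM n : (a n.+1 * q n <= q n.+1)%N.
Proof. by rewrite -[q n.+1]/(prev_den n.+2) prev_denSS leq_addr. Qed.

Lemma double_convergent_den n : (2 * q n <= q n.+2)%N.
Proof.
rewrite -[q n.+2]/(prev_den n.+3) prev_denSS mul2n -addnn leq_add2r.
by rewrite (leq_trans (leq_convergent_denS n))// leq_pmull// partial_quotient_gt0.
Qed.

(** The determinant identity p_(n-1) q_n - p_n q_(n-1) = (-1)^n, in the form in
    which it is used: the p's have been replaced by gaps. *)
Lemma prev_det n :
  (prev_den n.+1)%:R * prev_gap n - (prev_den n)%:R * prev_gap n.+1
    = (-1) ^+ n.+1 :> R.
Proof.
elim: n => [|n IH]; first by rewrite /prev_gap/=; ring.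
by rewrite prev_gapSS prev_denSS natrD natrM exprS -IH; ring.
Qed.

(** Since consecutive gaps have opposite signs, the two terms of the
    determinant identity add up in absolute value, so each is at most 1. *)
Lemma prev_gap_le n : (prev_den n.+1)%:R * `|prev_gap n| <= 1.
Proof.
have [/andP[t0 t1] D _] := frac_quotient_step n.
have := congr1 Num.norm (prev_det n).
rewrite normrX normrN1 expr1n D.
have -> : (prev_den n.+1)%:R * prev_gap n -
  (prev_den n)%:R * - (frac_quotient n * prev_gap n) =
  ((prev_den n.+1)%:R + (prev_den n)%:R * frac_quotient n) * prev_gap n by ring.
have Qt : 0 <= (prev_den n)%:R * frac_quotient n by rewrite mulr_ge0// ltW.
by rewrite normrM => e; rewrite -[leRHS]e ler_wpM2r// ger0_norm ?lerDl ?addr_ge0.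
Qed.

End ContinuedFractionFacts.

(** * Arithmetic on the torus *)

Section TorusFacts.
Context {R : realType}.
Implicit Types (x y : R) (t u : torus R).

Lemma mod1_repr t : mod1 (repr t) = t.
Proof. exact: reprK. Qed.

Lemma mod1_0 : mod1 (0 : R) = 0.
Proof. by rewrite -(subrr (0 : R)) -mod1B subrr. Qed.

Lemma mod1D x y : mod1 (x + y) = mod1 x + mod1 y.
Proof.
by rewrite -{1}[y]opprK -mod1B -[- y]sub0r -mod1B mod1_0 sub0r opprK.
Qed.

Lemma mod1Mn x n : mod1 (x *+ n) = mod1 x *+ n.
Proof. by elim: n => [|n IH]; rewrite ?mulr0n ?mod1_0// !mulrS mod1D IH. Qed.

Lemma mod1_sum (F : nat -> R) N :
  mod1 (\sum_(0 <= k < N) F k) = \sum_(0 <= k < N) mod1 (F k).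
Proof. by rewrite (big_morph _ mod1D mod1_0). Qed.

Lemma tnormD t u : tnorm (t + u) <= tnorm t + tnorm u.
Proof.
by rewrite -[t]mod1_repr -[u]mod1_repr -mod1D !tnorm_mod1 dist_intD.
Qed.

Lemma tnorm_ge0 t : 0 <= tnorm t.
Proof. exact: dist_int_ge0. Qed.

Lemma tnorm0 : tnorm (0 : torus R) = 0.
Proof. by rewrite -mod1_0 tnorm_mod1 dist_int0. Qed.

Lemma tnormMn t n : tnorm (t *+ n) <= tnorm t *+ n.
Proof.
elim: n => [|n IH]; first by rewrite !mulr0n tnorm0.
by rewrite !mulrS (le_trans (tnormD _ _))// lerD2l.
Qed.

Lemma tnorm_sum (F : nat -> torus R) N :
  tnorm (\sum_(0 <= k < N) F k) <= \sum_(0 <= k < N) tnorm (F k).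
Proof.
apply: (big_ind2 (fun t (r : R) => tnorm t <= r)) => [|t1 r1 t2 r2 h1 h2|//].
  by rewrite tnorm0.
by rewrite (le_trans (tnormD _ _))// lerD.
Qed.

Lemma cvg_torus (u : nat -> torus R) t :
  u @ \oo --> t <->
  forall e : R, 0 < e -> \forall n \near \oo, tnorm (t - u n) < e.
Proof. exact: cvg_ballP. Qed.

End TorusFacts.

(** * The geometric kernel *)

Definition nat_dist (n k : nat) : nat := ((n - k) + (k - n))%N.

(** A two-sided geometric series; the induction on k shifts the peak of the
    summand by one place and adds the term c ^ (k + 1) at the left end. *)
Lemma sum_expr_nat_dist (R : realType) (c : R) (k N : nat) : 0 <= c < 1 ->
  \sum_(0 <= n < N) c ^+ nat_dist n k <= 2 / (1 - c).
Proof.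
move=> /andP[c0 c1]; have c1' : 0 < 1 - c by lra.
rewrite ler_pdivlMr//.
(* The right-hand side is the sum of all c ^ |n - k| over n >= 0, times 1 - c. *)
suff h : (\sum_(0 <= n < N) c ^+ nat_dist n k) * (1 - c) <= 1 + c - c ^+ k.+1.
  by have := exprn_ge0 k.+1 c0; lra.
elim: k N => [|k IH] N.
  rewrite (_ : \sum_(0 <= n < N) _ = \sum_(0 <= n < N) c ^+ n); last first.
    by apply: eq_bigr => i _; rewrite /nat_dist subn0 sub0n addn0.
  have -> : (\sum_(0 <= n < N) c ^+ n) * (1 - c) = 1 - c ^+ N.
    elim: N => [|N IH]; first by rewrite big_geq// expr0 subrr mul0r.
    by rewrite big_nat_recr//= mulrDl IH exprS; ring.
  by have := exprn_ge0 N c0; rewrite expr1; lra.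
case: N => [|N].
  rewrite big_geq// mul0r.
  have := exprn_ile1 k.+2 c0 (ltW c1); lra.
rewrite big_nat_recl// mulrDl.
have -> : nat_dist 0 k.+1 = k.+1 by rewrite /nat_dist sub0n subn0.
have := IH N; rewrite /nat_dist.
under [in X in _ -> X]eq_bigr do rewrite !subSS.
by rewrite [c ^+ k.+2]exprS; lra.
Qed.

(** * Size of a convergent expansion *)

Section Forward.
Context {R : realType} (alpha : R).
Context (alpha01 : 0 < alpha < 1) (alpha_irr : irrational alpha).
Notation a := (partial_quotient alpha).
Notation q := (convergent_den alpha).

(** Denominators double every two steps, so they grow at least like any ratio
    up to the square root of 2.  The ratio used is decay ^ (-2), which requires
    decay ^ 4 >= 1/2.  The square is there because the estimates spend one
    factor decay ^ |n - k| on the convergence of a geometric series and keep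
    the other as a weight. *)
Definition decay : R := 9 / 10.

Lemma decay01 : 0 < decay < 1.
Proof. by rewrite /decay; lra. Qed.

Lemma convergent_den_growth n j :
  (q n)%:R <= 2 * (decay ^+ j) ^+ 2 * (q (n + j))%:R :> R.
Proof.
suff [] : (q n)%:R <= 2 * (decay ^+ j) ^+ 2 * (q (n + j))%:R :> R /\
    (q n)%:R <= 2 * (decay ^+ j.+1) ^+ 2 * (q (n + j.+1))%:R :> R by [].
elim: j => [|j [IH0 IH1]].
  rewrite addn0 addn1 expr0 expr1 /decay.
  have h : (q n)%:R <= (q n.+1)%:R :> R.
    by rewrite ler_nat leq_convergent_denS.
  have h0 : (0 : R) <= (q n)%:R by rewrite ler0n.
  by split; lra.
split=> //; apply: le_trans IH0 _.
have -> : 2 * (decay ^+ j.+2) ^+ 2 * (q (n + j.+2))%:R =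
  2 * (decay ^+ j) ^+ 2 * (decay ^+ 4 * (q (n + j.+2))%:R).
  by rewrite !exprS expr0; ring.
rewrite ler_wpM2l//; first by rewrite mulr_ge0// sqr_ge0.
have := double_convergent_den alpha01 alpha_irr (n + j).
rewrite -(ler_nat R) natrM -!addnS /decay.
have h0 : (0 : R) <= (q (n + j.+2))%:R by rewrite ler0n.
by lra.
Qed.

Lemma convergent_den_le m n : (m <= n)%N ->
  (q m)%:R <= 2 * (decay ^+ (n - m)) ^+ 2 * (q n)%:R :> R.
Proof.
by move=> mn; have := convergent_den_growth m (n - m); rewrite subnKC.
Qed.

Lemma dist_int_den (c : int) n :
  dist_int (c%:~R * (q n)%:R * alpha) <= `|c%:~R| * `|prev_gap alpha n.+1|.
Proof.
rewrite -normrM; apply: le_trans (dist_int_le _ (c * (prev_num alpha n.+1)%:Z)) _.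
by rewrite intrM /prev_gap mulrBr mulrA.
Qed.

(** The integer q_k q_n times alpha can be reduced modulo 1 through either
    factor; reducing the factor with the larger index gives
    ||q_k q_n alpha|| <= q_min / q_(max+1), which decays geometrically in
    |n - k|, even after multiplication by a_(k+1). *)
Lemma tnorm_term_le (b : nat -> int) n k :
  tnorm (mod1 ((b k)%:~R * (q k)%:R * alpha) *+ q n) <=
  digit_ratio alpha b k * (2 * (decay ^+ nat_dist n k) ^+ 2).
Proof.
have a0 : 0 < (a k.+1)%:R :> R.
  by rewrite ltr0n partial_quotient_gt0.
have r0 : 0 <= digit_ratio alpha b k by rewrite /digit_ratio divr_ge0// ltW.
have bE : `|(b k)%:~R| = digit_ratio alpha b k * (a k.+1)%:R.
  by rewrite /digit_ratio divfK// gt_eqF.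
have aq : (a k.+1)%:R * (q k)%:R <= (q k.+1)%:R :> R.
  by rewrite -natrM ler_nat leq_partial_quotientM.
rewrite -mod1Mn tnorm_mod1; move: (digit_ratio _ _ _) r0 bE => r r0 bE.
have [nk|/ltnW kn] := leqP n k.
- have -> : (b k)%:~R * (q k)%:R * alpha *+ q n =
      (b k * (q n)%:Z)%:~R * (q k)%:R * alpha.
    by rewrite intrM -mulr_natr; ring.
  rewrite (le_trans (dist_int_den _ _))// intrM normrM bE -!mulrA ler_wpM2l//.
  have -> : nat_dist n k = (k - n)%N by rewrite /nat_dist; lia.
  have g := prev_gap_le alpha01 alpha_irr k.+1.
  have h := convergent_den_le nk.
  set w := 2 * _ in h *; set e := `|prev_gap _ _| in g *.
  have w0 : 0 <= w by rewrite mulr_ge0// sqr_ge0.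
  have e0 : 0 <= e by exact: normr_ge0.
  rewrite ger0_norm ?ler0n//.
  apply: (@le_trans _ _ (w * ((a k.+1)%:R * (q k)%:R * e))).
    rewrite [leRHS](_ : _ = (a k.+1)%:R * (w * (q k)%:R * e)); last by ring.
    by rewrite ler_wpM2l ?ler_wpM2r// ltW.
  rewrite ler_piMr//; apply: le_trans g.
  by rewrite ler_wpM2r.
- have -> : (b k)%:~R * (q k)%:R * alpha *+ q n =
      (b k * (q k)%:Z)%:~R * (q n)%:R * alpha.
    by rewrite intrM -mulr_natr; ring.
  rewrite (le_trans (dist_int_den _ _))// intrM normrM bE -!mulrA ler_wpM2l//.
  have -> : nat_dist n k = (n - k)%N by rewrite /nat_dist; lia.
  have g := prev_gap_le alpha01 alpha_irr n.+1.
  have kn1 : (k < n.+1)%N by [].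
  have := convergent_den_le kn1; rewrite subSS => h.
  set w := 2 * _ in h *; set e := `|prev_gap _ _| in g *.
  have w0 : 0 <= w by rewrite mulr_ge0// sqr_ge0.
  have e0 : 0 <= e by exact: normr_ge0.
  rewrite ger0_norm ?ler0n// mulrA.
  apply: le_trans (ler_wpM2r e0 (le_trans aq h)) _.
  by rewrite -mulrA ler_piMr.
Qed.

(** Bounding the sum over k by a supremum costs only the constant
    40 = 2 * 2 / (1 - decay), and lets every exponent gamma be treated at once,
    without distinguishing gamma <= 1 from gamma > 1. *)
Lemma tnorm_expansion_le (b : nat -> int) (x : torus R) n (B : R) :
  is_expansion alpha b x ->
  (forall k, digit_ratio alpha b k * decay ^+ nat_dist n k <= B) ->
  tnorm (x *+ q n) <= 40 * B.
Proof.
move=> bx hB; have /andP[d0 d1] := decay01.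
pose S N := series (fun n => mod1 ((b n)%:~R * (q n)%:R * alpha)) N : torus R.
(* The bound holds for the partial sums, and passes to the limit since
   t |-> t *+ q n is Lipschitz. *)
have SB N : tnorm (S N *+ q n) <= 40 * B.
  rewrite /S seriesEnat/= -sumrMnl (le_trans (tnorm_sum _ _))//.
  have B0 : 0 <= B.
    by apply: le_trans (hB 0%N); rewrite mulr_ge0// ?divr_ge0// exprn_ge0 ?ltW.
  have dS := @sum_expr_nat_dist _ decay n N.
  have : (\sum_(0 <= k < N) decay ^+ nat_dist k n) * (2 * B) <= 20 * (2 * B).
    rewrite ler_wpM2r ?mulr_ge0//.
    apply: (le_trans (dS _)); first by rewrite d1 ltW.
    by rewrite /decay ler_pdivrMr; lra.
  have -> : 20 * (2 * B) = 40 * B by ring.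
  apply: le_trans; rewrite mulr_suml; apply: ler_sum => k _.
  apply: le_trans (tnorm_term_le _ _ _) _.
  have -> : nat_dist k n = nat_dist n k by rewrite /nat_dist addnC.
  have -> : digit_ratio alpha b k * (2 * (decay ^+ nat_dist n k) ^+ 2) =
    decay ^+ nat_dist n k * (2 * (digit_ratio alpha b k * decay ^+ nat_dist n k)).
    by ring.
  by rewrite ler_wpM2l ?exprn_ge0 ?(ltW d0)// ler_wpM2l.
apply/ler_addgt0Pr => e e0.
have qn0 : 0 < (q n)%:R :> R by rewrite ltr0n convergent_den_gt0.
have /cvg_torus/(_ (e / (q n)%:R))[|N _ hN] := bx; first exact: divr_gt0.
have {}hN := hN N (leqnn N).
rewrite -[x in leLHS](subrK (S N)) mulrnDl addrC (le_trans (tnormD _ _))//.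
rewrite lerD// (le_trans (tnormMn _ _))// -mulr_natr -ler_pdivlMr//.
exact: ltW.
Qed.

End Forward.

(** * The expansion by nearest integers *)

Section Backward.
Context {R : realType} (alpha : R).
Context (alpha01 : 0 < alpha < 1) (alpha_irr : irrational alpha).
Notation a := (partial_quotient alpha).
Notation q := (convergent_den alpha).
Notation Q := (prev_den alpha).
Notation P := (prev_num alpha).
Notation D := (prev_gap alpha).

Definition nearest_int (x : R) : int := projT1 (cid (dist_int_attained x)).

Lemma nearest_intP (x : R) : `|x - (nearest_int x)%:~R| = dist_int x.
Proof. by rewrite /nearest_int; case: cid. Qed.

Lemma dist_int_le1 (x : R) : dist_int x <= 1.
Proof.
apply: le_trans (dist_int_le x (Num.floor x)) _.
have h1 := floor_le x; have h2 := floorD1_gt x.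
by rewrite intrD in h2; rewrite ler_norml; apply/andP; split; lra.
Qed.

Lemma prev_gap_le_decay n : `|D n| <= 2 * decay ^+ n.
Proof.
have /andP[d0 d1] := @decay01 R.
have h := convergent_den_le alpha01 alpha_irr (leq0n n).
have g := prev_gap_le alpha01 alpha_irr n.
rewrite subn0 in h.
have h1 : (decay ^+ n) ^+ 2 <= decay ^+ n :> R.
  by rewrite expr2 ler_piMr ?exprn_ge0 ?exprn_ile1// ltW.
apply: (@le_trans _ _ (2 * (decay ^+ n) ^+ 2)); last by rewrite ler_wpM2l.
have -> : `|D n| = (q 0)%:R * `|D n| by rewrite mul1r.
apply: le_trans (ler_wpM2r (normr_ge0 _) h) _.
have := sqr_ge0 (decay ^+ n : R); move: (_ ^+ 2) => w w0.
by rewrite -[leLHS]mulrA ler_piMr// mulr_ge0.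
Qed.

(** As Q satisfies the continued fraction recurrence, the defect of this
    recurrence at the nearest integers m is minus its defect at the residues
    Q_k y - m_k: it is an integer, and small compared with a_(n+1) when the
    residues are small.  The sign makes the expansion
    telescope. *)
Definition digit (y : R) (n : nat) : int :=
  let m k := nearest_int ((Q k)%:R * y) in
  (-1) ^+ n * (m n.+2 - (a n.+1)%:Z * m n.+1 - m n).

Definition residue (y : R) (n : nat) : R :=
  (Q n)%:R * y - (nearest_int ((Q n)%:R * y))%:~R.

Lemma normr_residue y n : `|residue y n| = tnorm (mod1 y *+ Q n).
Proof. by rewrite nearest_intP -mod1Mn tnorm_mod1 mulr_natl. Qed.

Lemma digitE y n : (digit y n)%:~R = (-1) ^+ n *
  ((a n.+1)%:R * residue y n.+1 + residue y n - residue y n.+2) :> R.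
Proof.
rewrite /digit /residue prev_denSS natrD natrM.
move: (nearest_int _) (nearest_int _) (nearest_int _) => m2 m1 m0.
rewrite intrM rmorphXn/= !intrB intrM; ring.
Qed.

(** Let e be the sequence of residues and v_n = e_(n+1) D_n - e_n D_(n+1).  The
    recurrence for D gives c_n D_(n+1) = - (v_(n+1) + v_n) for the unsigned digit
    c_n, so the signed sum telescopes to (-1)^N v_N - v_0; and e_0 = 0, D_0 = -1
    leave - v_0 = e_1, which is y up to an integer. *)
Lemma sum_digit_gap y N :
  \sum_(0 <= n < N) (digit y n)%:~R * D n.+1 =
  y - (nearest_int y)%:~R +
    (-1) ^+ N * (residue y N.+1 * D N - residue y N * D N.+1).
Proof.
elim: N => [|N IH].
  (* The residue at 0 comes from q_(-1) = 0. *)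
  have r0 : residue y 0 = 0.
    by apply: normr0_eq0; rewrite normr_residue tnorm0.
  rewrite big_geq// r0 /residue /= /prev_gap/= !mul1r; ring.
rewrite big_nat_recr//= {}IH digitE (prev_gapSS alpha N).
have -> : (-1) ^+ N.+1 = - (-1) ^+ N :> R by rewrite exprS mulN1r.
by ring.
Qed.

(** The gaps tend to 0 and the residues are bounded, so the remainder of
    sum_digit_gap tends to 0; replacing q_n alpha by the gap changes partial
    sums by integers only.  Thus every point has an expansion of this kind,
    and only the size of its digits depends on the point. *)
Lemma digit_expansion y : is_expansion alpha (digit y) (mod1 y).
Proof.
have /andP[d0 d1] := @decay01 R.
apply/cvg_torus => e e0.
have /cvgrPdist_lt/(_ (e / 4)) : (@decay R) ^+ n @[n --> \oo] --> (0 : R).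
  by apply: cvg_expr; rewrite ger0_norm// ltW.
have e4 : 0 < e / 4 by rewrite divr_gt0.
move=> /(_ e4); apply: filterS => N; rewrite sub0r normrN => hN.
have dN0 : 0 <= (@decay R) ^+ N by rewrite exprn_ge0// ltW.
rewrite ger0_norm// in hN.
rewrite seriesEnat/= -mod1_sum mod1B tnorm_mod1.
pose E := (-1) ^+ N * (residue y N.+1 * D N - residue y N * D N.+1).
have -> : dist_int (y - \sum_(0 <= k < N) (digit y k)%:~R * (q k)%:R * alpha)
    = dist_int (- E).
  apply: dist_int_congr.
  have -> : y - \sum_(0 <= k < N) (digit y k)%:~R * (q k)%:R * alpha - - E =
     (nearest_int y)%:~R - \sum_(0 <= k < N) (digit y k)%:~R * (P k.+1)%:R.
    have := sum_digit_gap y N; rewrite -/E.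
    under eq_bigr do rewrite mulrBr mulrA.
    by rewrite sumrB; lra.
  rewrite rpredB ?intr_int// rpred_sum// => k _.
  by rewrite rpredM ?intr_int// natr_int.
rewrite dist_intN (le_lt_trans (dist_int_le _ 0))// subr0.
rewrite /E normrM normrX normrN1 expr1n mul1r (le_lt_trans (ler_normB _ _))//.
rewrite !normrM.
have r1 k : `|residue y k| <= 1 by rewrite nearest_intP dist_int_le1.
have g0 := prev_gap_le_decay N; have := prev_gap_le_decay N.+1.
rewrite exprS => g1.
have dd : decay * decay ^+ N <= decay ^+ N :> R by rewrite ler_piMl// ltW.
have h0 : `|residue y N.+1| * `|D N| <= `|D N| by rewrite ler_piMl.
have h1 : `|residue y N| * `|D N.+1| <= `|D N.+1| by rewrite ler_piMl.
by lra.
Qed.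

Lemma digit_ratio_le y n :
  digit_ratio alpha (digit y) n <=
  tnorm (mod1 y *+ Q n) + tnorm (mod1 y *+ Q n.+1) + tnorm (mod1 y *+ Q n.+2).
Proof.
have a1 : 1 <= (a n.+1)%:R :> R by rewrite ler1n partial_quotient_gt0.
rewrite /digit_ratio ler_pdivrMr; last by lra.
rewrite digitE normrM normrX normrN1 expr1n mul1r -!normr_residue.
move: (residue _ _) (residue _ _) (residue _ _) => r2 r0 r1.
apply: le_trans (ler_normB _ _) _.
apply: le_trans (lerD (ler_normD _ _) (lexx _)) _.
rewrite normrM (ger0_norm (ler0n _ _)) !mulrDl.
have h0 : `|r0| <= `|r0| * (a n.+1)%:R by rewrite ler_peMr.
have h2 : `|r2| <= `|r2| * (a n.+1)%:R by rewrite ler_peMr.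
by rewrite [_ * `|r1|]mulrC; lra.
Qed.

End Backward.

(** * Sums of powers *)

Section PowerSums.
Context {R : realType} (gamma : R).
Context (gamma0 : 0 < gamma).

Lemma ler_powR_root (x y : R) : 0 <= x -> 0 <= y ->
  x `^ gamma <= y -> x <= y `^ gamma^-1.
Proof.
move=> x0 y0 xy.
have -> : x = (x `^ gamma) `^ gamma^-1.
  by rewrite -powRrM mulfV ?gt_eqF// powRr1.
by apply: ge0_ler_powR; rewrite ?nnegrE ?powR_ge0// invr_ge0 ltW.
Qed.

Lemma powR_root (y : R) : 0 <= y -> (y `^ gamma^-1) `^ gamma = y.
Proof. by move=> y0; rewrite -powRrM mulVf ?gt_eqF// powRr1. Qed.

Lemma powR_add3_le (x y z : R) : 0 <= x -> 0 <= y -> 0 <= z ->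
  (x + y + z) `^ gamma <= 3 `^ gamma * (x `^ gamma + y `^ gamma + z `^ gamma).
Proof.
move=> x0 y0 z0.
(* w is the largest of the three numbers. *)
suff [w [w0 sw pw]] : exists w, [/\ 0 <= w, x + y + z <= 3 * w &
    w `^ gamma <= x `^ gamma + y `^ gamma + z `^ gamma].
  apply: (@le_trans _ _ (3 `^ gamma * w `^ gamma)); last first.
    by rewrite ler_wpM2l// powR_ge0.
  rewrite -powRM//; apply: ge0_ler_powR; rewrite ?nnegrE ?mulr_ge0//.
    exact: ltW.
  by rewrite !addr_ge0.
have px := powR_ge0 x gamma; have py := powR_ge0 y gamma.
have pz := powR_ge0 z gamma.
have [xy|/ltW yx] := leP x y; [have [yz|/ltW zy] := leP y z|
  have [xz|/ltW zx] := leP x z].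
- by exists z; split=> //; lra.
- by exists y; split=> //; lra.
- by exists z; split=> //; lra.
- by exists x; split=> //; lra.
Qed.

Lemma powR_exprn (x : R) n : 0 <= x -> (x ^+ n) `^ gamma = (x `^ gamma) ^+ n.
Proof.
move=> x0; elim: n => [|n IH]; first by rewrite !expr0 powR1.
by rewrite !exprS powRM ?exprn_ge0// IH.
Qed.

Lemma nneseries_ub (f : nat -> R) (M : R) : (forall n, 0 <= f n) ->
  (forall N, \sum_(0 <= n < N) f n <= M) ->
  (\sum_(0 <= n <oo) (f n)%:E <= M%:E)%E.
Proof.
move=> f0 fM; apply: lime_le.
  by apply: is_cvg_nneseries => n _ _; rewrite lee_fin.
by apply: nearW => N; rewrite sumEFin lee_fin.
Qed.

Lemma nneseries_term_le (f : nat -> \bar R) k : (forall n, 0 <= f n)%E ->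
  (f k <= \sum_(0 <= n <oo) f n)%E.
Proof.
move=> f0; apply: le_trans (nneseries_lim_ge k.+1 _) => //.
by rewrite big_nat_recr//= leeDr// sume_ge0.
Qed.

(** Convolution with a geometric kernel is bounded on summable sequences:
    exchange the two sums. *)
Lemma kernel_convolution (c : R) (f : nat -> R) : 0 <= c < 1 ->
  (forall k, 0 <= f k) ->
  (\sum_(0 <= n <oo) \sum_(0 <= k <oo) (f k * c ^+ nat_dist n k)%:E <=
   (2 / (1 - c))%:E * \sum_(0 <= k <oo) (f k)%:E)%E.
Proof.
move=> c01 f0; have /andP[c0 c1] := c01.
have t0 n k : 0 <= f k * c ^+ nat_dist n k by rewrite mulr_ge0// exprn_ge0.
rewrite nneseries_interchange//.
rewrite -nneseriesZl//; last by move=> k _; rewrite lee_fin.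
apply: lee_nneseries => [k _ _|k _].
  by apply: nneseries_ge0 => n _ _; rewrite lee_fin.
rewrite -EFinM; apply: nneseries_ub => // N.
rewrite -mulr_sumr mulrC ler_wpM2r//; exact: sum_expr_nat_dist.
Qed.

(** A summable tail suffices: one initial term is finite. *)
Lemma nneseries_window (T : nat -> R) : (forall n, 0 <= T n) ->
  (\sum_(0 <= n <oo) (T n.+1)%:E < +oo)%E ->
  (\sum_(0 <= n <oo) ((T n)%:E + (T n.+1)%:E + (T n.+2)%:E) < +oo)%E.
Proof.
move=> T0 T1; have T0E n : (0 <= (T n)%:E)%E by rewrite lee_fin.
have Tsum : (\sum_(0 <= n <oo) (T n)%:E < +oo)%E.
  rewrite (nneseries_recl (f := fun n => (T n)%:E) (fun n _ => T0E n) isT).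
  rewrite -(nneseries_addn (f := fun n => (T n)%:E) 1 T0E).
  under eq_eseriesr do rewrite addn1.
  by apply: lte_add_pinfty T1; rewrite ltry.
have T2 : (\sum_(0 <= n <oo) (T n.+2)%:E < +oo)%E.
  apply: le_lt_trans T1.
  rewrite [leRHS](nneseries_recl (f := fun n => (T n.+1)%:E)
    (fun n _ => T0E n.+1) isT).
  rewrite -(nneseries_addn (f := fun n => (T n.+1)%:E) 1 (fun n => T0E n.+1)).
  by under [in leRHS]eq_eseriesr do rewrite addn1; rewrite leeDr.
have T01 n : (0 <= (T n)%:E + (T n.+1)%:E)%E by rewrite adde_ge0.
rewrite (nneseriesD (fun n _ _ => T01 n) (fun n _ _ => T0E n.+2)).
rewrite (nneseriesD (fun n _ _ => T0E n) (fun n _ _ => T0E n.+1)).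
by apply: lte_add_pinfty T2; exact: lte_add_pinfty.
Qed.

End PowerSums.

(** * The groups attached to alpha *)

Section Main.
Context {R : realType} (alpha : R).
Context (alpha01 : 0 < alpha < 1) (alpha_irr : irrational alpha).
Notation q := (convergent_den alpha).

Lemma digit_ratio_ge0 b n : 0 <= digit_ratio alpha b n.
Proof. by rewrite /digit_ratio divr_ge0. Qed.

(** The number E_n, the sum over k of r_k^gamma decay^(gamma |n - k|) for r the
    sequence of digit ratios, dominates each (r_k decay^|n - k|)^gamma; so its
    root is an admissible bound in tnorm_expansion_le, and the E_n are summable
    by kernel_convolution. *)
Lemma summable_tnorm (gamma : R) b (x : torus R) : 0 < gamma ->
  (\sum_(0 <= n <oo) (digit_ratio alpha b n `^ gamma)%:E < +oo)%E ->
  is_expansion alpha b x ->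
  (\sum_(0 <= n <oo) (tnorm (x *+ q n) `^ gamma)%:E < +oo)%E.
Proof.
move=> g0 bsum bx; have /andP[d0 d1] := @decay01 R.
pose r := digit_ratio alpha b; pose c := decay `^ gamma : R.
have c01 : 0 <= c < 1.
  rewrite powR_ge0 /= /c.
  have /= := @gt0_ltr_powR R gamma g0 decay 1.
  by rewrite powR1; apply => //; rewrite nnegrE// ltW.
have /andP[c0 c1] := c01.
have r0 k : 0 <= r k `^ gamma by exact: powR_ge0.
pose F n k := r k `^ gamma * c ^+ nat_dist n k.
have F0 n k : 0 <= F n k by rewrite mulr_ge0// exprn_ge0.
pose E n := (\sum_(0 <= k <oo) (F n k)%:E)%E.
have E0 n : (0 <= E n)%E.
  by apply: nneseries_ge0 => k _ _; rewrite lee_fin.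
have Efin n : E n \is a fin_num.
  rewrite ge0_fin_numE//; apply: le_lt_trans bsum.
  apply: lee_nneseries => [k _ _|k _]; rewrite lee_fin//.
  by rewrite ler_piMr// exprn_ile1// ltW.
have tE n : ((tnorm (x *+ q n) `^ gamma)%:E <= (40 `^ gamma)%:E * E n)%E.
  rewrite -(fineK (Efin n)) -EFinM lee_fin.
  have fE0 : 0 <= fine (E n) by rewrite fine_ge0.
  rewrite -[fine (E n)](powR_root g0)// -powRM ?powR_ge0//.
  apply: ge0_ler_powR; rewrite ?nnegrE ?tnorm_ge0 ?mulr_ge0 ?powR_ge0//.
    exact: ltW.
  apply: (tnorm_expansion_le alpha01 alpha_irr bx) => k.
  have rk0 := digit_ratio_ge0 b k.
  have dk0 : 0 <= decay ^+ nat_dist n k :> R by rewrite exprn_ge0// ltW.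
  apply: ler_powR_root; rewrite ?mulr_ge0//.
  rewrite powRM// powR_exprn ?(ltW d0)// -/c -lee_fin fineK//.
  by apply: (@nneseries_term_le _ (fun k => (F n k)%:E)) => j; rewrite lee_fin.
apply: (@le_lt_trans _ _ ((40 `^ gamma)%:E * \sum_(0 <= n <oo) E n)%E).
  rewrite -nneseriesZl//; apply: lee_nneseries => // n _ _.
  by rewrite lee_fin powR_ge0.
rewrite lte_mul_pinfty ?lee_fin ?powR_ge0//.
apply: le_lt_trans (kernel_convolution c01 r0) _.
by rewrite lte_mul_pinfty// lee_fin divr_ge0// subr_ge0 ltW.
Qed.

(** Far digits have small ratios; the finitely many others have a bounded ratio
    and a weight decay^|n - k| that is small once n is large. *)
Lemma cvg_tnorm b (x : torus R) :
  digit_ratio alpha b n @[n --> \oo] --> (0 : R) ->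
  is_expansion alpha b x ->
  tnorm (x *+ q n) @[n --> \oo] --> (0 : R).
Proof.
move=> b0 bx; have /andP[d0 d1] := @decay01 R.
apply/cvgrPdist_le => e e0.
have e40 : 0 < e / 40 by rewrite divr_gt0.
have /cvgrPdist_le/(_ _ e40)[n0 _ hn0] := b0.
pose M := \sum_(0 <= k < n0) digit_ratio alpha b k.
have M0 : 0 <= M by apply: sumr_ge0 => k _; exact: digit_ratio_ge0.
have eM : 0 < e / 40 / (M + 1) by rewrite divr_gt0// ltr_wpDl.
have /cvgrPdist_le/(_ _ eM)[n1 _ hn1] : (@decay R) ^+ n @[n --> \oo] --> (0 : R).
  by apply: cvg_expr; rewrite ger0_norm// ltW.
exists (n0 + n1)%N => // n /= hn.
rewrite sub0r normrN ger0_norm ?tnorm_ge0//.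
have -> : e = 40 * (e / 40) by rewrite mulrC divfK.
apply: (tnorm_expansion_le alpha01 alpha_irr bx) => k.
have rk0 := digit_ratio_ge0 b k.
have [kn0|n0k] := ltnP k n0; last first.
  have := hn0 k n0k; rewrite sub0r normrN ger0_norm//.
  by apply: le_trans; rewrite ler_piMr// exprn_ile1// ltW.
have kM : digit_ratio alpha b k <= M.
  rewrite /M big_mkord (bigD1 (Ordinal kn0))//= lerDl sumr_ge0// => j _.
  exact: digit_ratio_ge0.
have n1d : (n1 <= nat_dist n k)%N.
  by rewrite (leq_trans _ (leq_addr _ _))// -(addKn n0 n1) leq_sub// ltnW.
have dk0 : 0 <= (@decay R) ^+ nat_dist n k by rewrite exprn_ge0// ltW.
have := hn1 _ n1d; rewrite sub0r normrN ger0_norm//.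
rewrite ler_pdivlMr ?ltr_wpDl// => h; apply: le_trans h.
by rewrite mulrC ler_wpM2l//; lra.
Qed.

Lemma summable_digit (gamma y : R) : 0 < gamma ->
  (\sum_(0 <= n <oo) (tnorm (mod1 y *+ q n) `^ gamma)%:E < +oo)%E ->
  (\sum_(0 <= n <oo) (digit_ratio alpha (digit alpha y) n `^ gamma)%:E < +oo)%E.
Proof.
move=> g0 ysum.
pose T n := tnorm (mod1 y *+ prev_den alpha n) `^ gamma.
have T0 n : 0 <= T n by exact: powR_ge0.
have TE n : (0 <= (T n)%:E + (T n.+1)%:E + (T n.+2)%:E)%E.
  by rewrite -!EFinD lee_fin !addr_ge0.
have Tsum := nneseries_window T0 ysum.
apply: (@le_lt_trans _ _ ((3 `^ gamma)%:E *
    \sum_(0 <= n <oo) ((T n)%:E + (T n.+1)%:E + (T n.+2)%:E))%E).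
  rewrite -(nneseriesZl _ _ (fun n _ => TE n)).
  apply: lee_nneseries => [n _ _|n _]; first by rewrite lee_fin powR_ge0.
  rewrite -!EFinD -EFinM lee_fin.
  apply: le_trans (powR_add3_le g0 _ _ _); rewrite ?tnorm_ge0//.
  apply: ge0_ler_powR; rewrite ?nnegrE ?addr_ge0 ?tnorm_ge0 ?digit_ratio_ge0//.
    exact: ltW.
  exact: digit_ratio_le.
by apply: lte_mul_pinfty; rewrite ?lee_fin ?powR_ge0.
Qed.

Lemma cvg_digit (y : R) :
  tnorm (mod1 y *+ q n) @[n --> \oo] --> (0 : R) ->
  digit_ratio alpha (digit alpha y) n @[n --> \oo] --> (0 : R).
Proof.
move=> y0.
pose T n := tnorm (mod1 y *+ prev_den alpha n).
have T1 : T n.+1 @[n --> \oo] --> (0 : R) by [].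
have T2 : T n.+2 @[n --> \oo] --> (0 : R) by rewrite (cvg_shiftS (fun n => T n.+1)).
have T00 : T n @[n --> \oo] --> (0 : R) by rewrite -cvg_shiftS.
apply: (@squeeze_cvgr _ _ _ _ (cst 0) (fun n => T n + T n.+1 + T n.+2)).
- by apply: nearW => n; rewrite digit_ratio_ge0 digit_ratio_le.
- exact: cvg_cst.
- rewrite -[X in _ --> X](addr0 0) -[X in _ --> X + _](addr0 0).
  by apply: cvgD; [apply: cvgD|].
Qed.

End Main.

Theorem proposition1 (R : realType) (alpha : R)
  (alpha01 : 0 < alpha < 1) (alpha_irr : irrational alpha) :
  (forall gamma : R, 0 < gamma ->
     H_gamma alpha gamma =
     [set x : torus R |
       (\sum_(0 <= n <oo)
          (tnorm (x *+ convergent_den alpha n) `^ gamma)%:E < +oo)%E]) /\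
  H_infty alpha =
  [set x : torus R |
    tnorm (x *+ convergent_den alpha n) @[n --> \oo] --> (0 : R)].
Proof.
have lift (x : torus R) : exists y, x = mod1 y.
  by exists (repr x); rewrite mod1_repr.
split=> [gamma gamma0|]; apply/seteqP; split=> [x [b [hb bx]]|x].
- exact: summable_tnorm gamma0 hb bx.
- have [y ->] := lift x => hx; exists (digit alpha y).
  split; last exact: digit_expansion.
  exact: (summable_digit alpha01 alpha_irr gamma0 hx).
- exact: cvg_tnorm hb bx.
- have [y ->] := lift x => hx; exists (digit alpha y).
  split; last exact: digit_expansion.
  exact: (cvg_digit alpha01 alpha_irr hx).
Qed.
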